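(* (Triple quad formula) Let $\mathbb{F}$ be a field of characteristic not $2$ and let $B$ be an invertible symmetric $3\times 3$ matrix over $\mathbb{F}$. Let $\overline{v_1v_2v_3}$ be a vector triangle in $\mathbb{V}^3=\mathbb{F}^3$ with $B$-quadrances $Q_1,Q_2,Q_3$. If $\overline{v_1v_2v_3}$ is degenerate, then $$(Q_1+Q_2+Q_3)^2=2\left(Q_1^2+Q_2^2+Q_3^2\right).$$
   Context: $\mathbb{V}^3$ is the space of row vectors over $\mathbb{F}$. The $B$-scalar product is $v\cdot_B w=vBw^T$ and the $B$-quadrance is $Q_B(v)=v\cdot_B v$. A vector triangle $\overline{v_1v_2v_3}$ is an unordered collection of three vectors with $v_1+v_2+v_3=\mathbf{0}$; its $B$-quadrances are $Q_i=Q_B(v_i)$. It is degenerate when $v_1,v_2,v_3$ are collinear, i.e. all lie in a common one-dimensional subspace. *)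

(* Defs.v *)
From mathcomp Require Import all_boot all_order all_algebra.

Set Implicit Arguments.
Unset Strict Implicit.
Unset Printing Implicit Defensive.

Import GRing.Theory.
Local Open Scope ring_scope.

(* v B w^T is a 1 x 1 matrix; the scalar is its only entry. *)
Definition Bdot (F : fieldType) (B : 'M[F]_3) (v w : 'rV[F]_3) : F :=
  (v *m B *m w^T) 0 0.

Definition Bquadrance (F : fieldType) (B : 'M[F]_3) (v : 'rV[F]_3) : F :=
  Bdot B v v.

(* An unordered collection (possibly with repetitions) of three vectors is
   represented by an arbitrary listing v1, v2, v3 of its members; the two
   predicates below do not depend on the listing. *)
Definition vector_triangle (F : fieldType) (v1 v2 v3 : 'rV[F]_3) : Prop :=
  v1 + v2 + v3 = 0.

Definition degenerate_triangle (F : fieldType) (v1 v2 v3 : 'rV[F]_3) : Prop :=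
  exists U : {vspace 'rV[F]_3},
    [/\ \dim U = 1%N, v1 \in U, v2 \in U & v3 \in U].

(* Main.v *)
Require Import Defs.
From mathcomp Require Import all_boot all_order all_algebra.
From mathcomp Require Import ring.
Import GRing.Theory.
Local Open Scope ring_scope.

(** On a line spanned by a nonzero [u], write v_i = a_i u.  The triangle
    condition becomes a1 + a2 + a3 = 0, and the quadrance is a quadratic form,
    so Q_i = a_i ^ 2 Q(u).  The two sides of the claim are then Q(u) ^ 2 times
    the two sides of (a^2 + b^2 + c^2)^2 = 2 (a^4 + b^4 + c^4), which holds for
    scalars of sum zero because of the factorization behind Heron's formula:
    (a^2 + b^2 + c^2)^2 - 2 (a^4 + b^4 + c^4)
      = (a + b + c) (a + b - c) (a - b + c) (- a + b + c).  *)

Lemma Bquadrance_scale (F : fieldType) (B : 'M[F]_3) (a : F) (v : 'rV[F]_3) :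
  Bquadrance B (a *: v) = a ^+ 2 * Bquadrance B v.
Proof.
by rewrite /Bquadrance /Bdot linearZ /= -!scalemxAl -scalemxAr !mxE mulrA.
Qed.

Lemma dimv1_vline (K : fieldType) (vT : vectType K) (U : {vspace vT}) :
  \dim U = 1%N -> exists2 u, u != 0 & U = <[u]>%VS.
Proof.
move=> dimU; have u_neq0 : vpick U != 0 by rewrite vpick0 -dimv_eq0 dimU.
exists (vpick U) => //; apply/eqP.
by rewrite eq_sym eqEdim -memvE memv_pick dim_vline u_neq0 dimU.
Qed.

Theorem theorem19 (F : fieldType) (char_not2 : 2%N \notin [pchar F])
    (B : 'M[F]_3) (B_inv : B \in unitmx) (B_sym : B^T = B)
    (v1 v2 v3 : 'rV[F]_3) (tri : vector_triangle v1 v2 v3)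
    (Q1 Q2 Q3 : F) (Q1E : Q1 = Bquadrance B v1)
    (Q2E : Q2 = Bquadrance B v2) (Q3E : Q3 = Bquadrance B v3)
    (degen : degenerate_triangle v1 v2 v3) :
  (Q1 + Q2 + Q3) ^+ 2 = 2%:R * (Q1 ^+ 2 + Q2 ^+ 2 + Q3 ^+ 2).
Proof.
have [U [/dimv1_vline[u u_neq0 ->]]] := degen.
move=> /vlineP[a v1E] /vlineP[b v2E] /vlineP[c v3E].
have abc0 : a + b + c = 0.
  move/eqP: tri; rewrite v1E v2E v3E -!scalerDl scaler_eq0 (negPf u_neq0) orbF.
  exact/eqP.
have cE : c = - (a + b) by apply/eqP; rewrite -addr_eq0 addrC abc0.
by rewrite Q1E Q2E Q3E v1E v2E v3E !Bquadrance_scale cE; ring.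
Qed.
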